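(* Let $\mathcal{A}\in\mathbb{C}^{\mathbf{I}(N)\times\mathbf{I}(N)}$ with $\mathrm{ind}(\mathcal{A})=1$. Then $$\mathcal{A}^{\#}=\mathcal{A}*_N(\mathcal{A}^{3})^{(1)}*_N\mathcal{A},$$ where $(\mathcal{A}^{3})^{(1)}$ is an arbitrary $\{1\}$-inverse of $\mathcal{A}^{3}$.
   Context: For positive integers $I_1,\dots,I_N$ write $\mathbf{I}(N)=I_1\times\cdots\times I_N$; $\mathbb{C}^{\mathbf{I}(N)\times\mathbf{J}(N)}$ is the set of complex tensors with entries $a_{i_1\dots i_N j_1\dots j_N}$, $1\le i_s\le I_s$, $1\le j_s\le J_s$. The Einstein product of $\mathcal{A}\in\mathbb{C}^{\mathbf{I}(N)\times\mathbf{K}(N)}$ and $\mathcal{B}\in\mathbb{C}^{\mathbf{K}(N)\times\mathbf{J}(N)}$ is $(\mathcal{A}*_N\mathcal{B})_{i_1\dots i_N j_1\dots j_N}=\sum_{k_1,\dots,k_N}a_{i_1\dots i_N k_1\dots k_N}b_{k_1\dots k_N j_1\dots j_N}$; similarly $\mathcal{A}*_N\mathcal{X}\in\mathbb{C}^{\mathbf{I}(N)}$ for $\mathcal{X}\in\mathbb{C}^{\mathbf{K}(N)}$. Powers of $\mathcal{A}\in\mathbb{C}^{\mathbf{I}(N)\times\mathbf{I}(N)}$ are taken with $*_N$, and $\mathcal{A}^0=\mathcal{I}$ is the identity tensor. The range of $\mathcal{A}$ is $\mathfrak{R}(\mathcal{A})=\{\mathcal{A}*_N\mathcal{X}:\mathcal{X}\in\mathbb{C}^{\mathbf{I}(N)}\}$.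 The index $\mathrm{ind}(\mathcal{A})$ is the smallest nonnegative integer $k$ with $\mathfrak{R}(\mathcal{A}^k)=\mathfrak{R}(\mathcal{A}^{k+1})$. The Drazin inverse $\mathcal{A}^D$ of $\mathcal{A}$ with $\mathrm{ind}(\mathcal{A})=k$ is the (unique, always existing) tensor $\mathcal{X}\in\mathbb{C}^{\mathbf{I}(N)\times\mathbf{I}(N)}$ with $\mathcal{A}^{k+1}*_N\mathcal{X}=\mathcal{A}^k$, $\mathcal{X}*_N\mathcal{A}*_N\mathcal{X}=\mathcal{X}$, $\mathcal{A}*_N\mathcal{X}=\mathcal{X}*_N\mathcal{A}$. When $k=1$, $\mathcal{A}^D$ is called the group inverse and denoted $\mathcal{A}^{\#}$. A $\{1\}$-inverse of $\mathcal{A}$ is any $\mathcal{X}\in\mathbb{C}^{\mathbf{I}(N)\times\mathbf{I}(N)}$ with $\mathcal{A}*_N\mathcal{X}*_N\mathcal{A}=\mathcal{A}$; it is denoted $\mathcal{A}^{(1)}$. *)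

(* Defs.v *)
From mathcomp Require Import all_boot all_order all_algebra.
From mathcomp Require Import boolp classical_sets reals complex.

Set Implicit Arguments.
Unset Strict Implicit.
Unset Printing Implicit Defensive.

Import GRing.Theory.

Local Open Scope ring_scope.
Local Open Scope complex_scope.

(* Multi-indices (i_1, ..., i_N), counted from 0: i_s ranges over 'I_(I s). *)
Definition midx (N : nat) (I : 'I_N -> nat) : finType :=
  {dffun forall s : 'I_N, 'I_(I s)}.

Definition vtensor (R : realType) (N : nat) (I : 'I_N -> nat) : Type :=
  {ffun midx I -> R[i]}.

Definition tensor (R : realType) (N : nat) (I J : 'I_N -> nat) : Type :=
  {ffun midx I * midx J -> R[i]}.

Definition einstein (R : realType) (N : nat) (I K J : 'I_N -> nat)
    (A : tensor R I K) (B : tensor R K J) : tensor R I J :=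
  [ffun ij => \sum_(k : midx K) A (ij.1, k) * B (k, ij.2)].

Definition einsteinv (R : realType) (N : nat) (I K : 'I_N -> nat)
    (A : tensor R I K) (X : vtensor R K) : vtensor R I :=
  [ffun i => \sum_(k : midx K) A (i, k) * X k].

Declare Scope tensor_scope.
Delimit Scope tensor_scope with T.
Notation "A *N B" := (einstein A B)
  (at level 40, left associativity) : tensor_scope.
Local Open Scope tensor_scope.

Definition idtensor (R : realType) (N : nat) (I : 'I_N -> nat) :
    tensor R I I :=
  [ffun ij => (ij.1 == ij.2)%:R].

Definition tpow (R : realType) (N : nat) (I : 'I_N -> nat)
    (A : tensor R I I) (k : nat) : tensor R I I :=
  iter k (einstein A) (idtensor R I).

Definition trange (R : realType) (N : nat) (I : 'I_N -> nat)
    (A : tensor R I I) : set (vtensor R I) :=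
  range (einsteinv A).

Lemma drazin_ring (T : pzRingType) (a y z : T) (k : nat) :
  a ^+ k = a ^+ k.+1 * y -> a ^+ k = z * a ^+ k.+1 ->
  exists x, [/\ a ^+ k.+1 * x = a ^+ k, x * a * x = x & a * x = x * a].
Proof.
move=> ay az.
have ayX m : a ^+ k = a ^+ (m + k) * y ^+ m.
  elim: m => [|m IH]; first by rewrite mulr1.
  by rewrite [LHS]IH exprD ay mulrA -exprD -mulrA -exprS addnS.
have azX m : a ^+ k = z ^+ m * a ^+ (k + m).
  elim: m => [|m IH]; first by rewrite mul1r addn0.
  by rewrite [LHS]IH exprD az !mulrA -exprSr -mulrA -exprD addSnnS.
have {ay ayX} := ayX k.+1; have {az azX} := azX k.+1.
move: (y ^+ k.+1) (z ^+ k.+1) => {}y {}z; rewrite [(k + _)%N]addnC => az ay.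
have E : a ^+ k * y = z * a ^+ k by rewrite {1}az {1}ay mulrA.
exists (a ^+ k * y); split.
- by rewrite mulrA -exprD -ay.
- rewrite {1}E -!mulrA (mulrA a) -exprS (mulrA (a ^+ k)) -exprD addnC.
  by rewrite -ay -E.
- have -> : a ^+ k * y * a = z * a ^+ k.+1 by rewrite E -mulrA -exprSr.
  rewrite mulrA -exprS exprSr {1}az -(mulrA z) -(commrX _ (commr_refl a)).
  by rewrite -!mulrA -ay -exprS -exprSr.
Qed.

Lemma drazin_ring_unique (T : pzRingType) (a x y : T) (k : nat) :
  a ^+ k.+1 * x = a ^+ k -> x * a * x = x -> a * x = x * a ->
  a ^+ k.+1 * y = a ^+ k -> y * a * y = y -> a * y = y * a -> x = y.
Proof.
move=> x1 x2 x3 y1 y2 y3.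
have fac w : w * a * w = w -> a * w = w * a ->
    forall m, exists v, w = v * a ^+ m /\ w = a ^+ m * v.
  move=> w2 w3; elim=> [|m [v [v1 v2]]]; first by exists w; rewrite mulr1 mul1r.
  have wX n : GRing.comm w (a ^+ n) by apply: commrX; exact/esym.
  exists (w * v); split.
    by rewrite exprSr mulrA -(mulrA w v) -v1 -mulrA -w3 mulrA w2.
  by rewrite mulrA -wX exprS -!mulrA -v2 mulrA w2.
have [u [u1 _]] := fac x x2 x3 k; have [v [_ v2]] := fac y y2 y3 k.
have xay : x * a * y = x.
  by rewrite {1}u1 -(mulrA u) -exprSr -mulrA y1.
have ax1 : x * a ^+ k.+1 = a ^+ k.
  by rewrite -[RHS]x1; apply: commrX; exact/esym.
by rewrite -xay {1}v2 mulrA -(mulrA x) -exprS ax1 -v2.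
Qed.

(* Transport to square matrices, used only to prove that the index and the
   Drazin inverse exist. *)
Section Transport.
Variables (R : realType) (N : nat) (I : 'I_N -> nat).
Implicit Types A B : tensor R I I.

Definition tomx A : 'M[R[i]]_#|midx I| :=
  \matrix_(i, j) A (enum_val i, enum_val j).

Definition ofmx (M : 'M[R[i]]_#|midx I|) : tensor R I I :=
  [ffun ij => M (enum_rank ij.1) (enum_rank ij.2)].

Lemma tomxK : cancel tomx ofmx.
Proof. by move=> A; apply/ffunP => -[i j]; rewrite ffunE mxE !enum_rankK. Qed.

Lemma ofmxK : cancel ofmx tomx.
Proof. by move=> M; apply/matrixP => i j; rewrite mxE ffunE !enum_valK. Qed.

Lemma tomxM A B : tomx (A *N B) = tomx A *m tomx B.
Proof.
apply/matrixP => i j; rewrite !mxE ffunE /=.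
rewrite (reindex (@enum_val _ (mem (midx I)))) /=; last first.
  exact/onW_bij/enum_val_bij.
by apply: eq_bigr => k _; rewrite !mxE.
Qed.

Lemma tomx1 : tomx (idtensor R I) = 1%:M.
Proof.
by apply/matrixP => i j; rewrite !mxE ffunE /= (inj_eq enum_val_inj).
Qed.

Lemma tomxX A k : tomx (tpow A k) = tomx A ^+ k.
Proof. by elim: k => [|k IH]; rewrite ?tomx1 // exprS -IH -mulmxE -tomxM. Qed.

Lemma einsteinA A B (C : tensor R I I) : A *N (B *N C) = A *N B *N C.
Proof. by apply: (can_inj tomxK); rewrite !tomxM mulmxA. Qed.

Lemma einsteinvA A B X : einsteinv (A *N B) X = einsteinv A (einsteinv B X).
Proof.
apply/ffunP => i; rewrite !ffunE.
under eq_bigr do rewrite ffunE /= mulr_suml.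
rewrite exchange_big /=; apply: eq_bigr => k _.
by rewrite ffunE mulr_sumr; apply: eq_bigr => l _; rewrite mulrA.
Qed.

Lemma trange_sub A B :
  (trange A `<=` trange B)%classic <-> exists Y, A = B *N Y.
Proof.
split=> [AB|[Y ->] _ [X _ <-]]; last first.
  by exists (einsteinv Y X) => //; rewrite einsteinvA.
have colP (j : midx I) :
    exists X : vtensor R I, einsteinv B X = [ffun i => A (i, j)].
  have [|X _ BX] := AB [ffun i => A (i, j)]; last by exists X.
  exists [ffun k => (k == j)%:R] => //; apply/ffunP => i; rewrite !ffunE.
  rewrite (bigD1 j) //= ffunE eqxx mulr1 big1 ?addr0 // => k /negPf kj.
  by rewrite ffunE kj mulr0.
have [Y BY] := choice colP.
exists [ffun kj => Y kj.2 kj.1]; apply/ffunP => -[i j].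
have /ffunP/(_ i) := BY j; rewrite !ffunE /= => <-.
by apply: eq_bigr => k _; rewrite ffunE.
Qed.

Lemma trange_subT A B : (trange A `<=` trange B)%classic <->
  ((tomx A)^T <= (tomx B)^T)%MS.
Proof.
rewrite trange_sub; split=> [[Y ->]|/submxP[D]].
  by rewrite tomxM trmx_mul submxMl.
move/(congr1 trmx); rewrite trmx_mul !trmxK => AE.
by exists (ofmx D^T); apply: (can_inj tomxK); rewrite tomxM ofmxK.
Qed.

Lemma tpowS_sub A k : ((tomx (tpow A k.+1))^T <= (tomx (tpow A k))^T)%MS.
Proof. by rewrite !tomxX exprSr -mulmxE trmx_mul submxMl. Qed.

Lemma trange_rank A k : trange (tpow A k) = trange (tpow A k.+1) <->
  \rank (tomx (tpow A k)) = \rank (tomx (tpow A k.+1)).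
Proof.
rewrite -[in X in _ <-> X]mxrank_tr -[in X in _ <-> _ = X]mxrank_tr.
have sub := tpowS_sub A k; split=> [E|/esym/eqP E].
  apply/eqP; rewrite eqn_leq [X in _ && X]mxrankS // mxrankS //.
  by apply/trange_subT; rewrite E.
apply/seteqP; split; apply/trange_subT => //.
by rewrite -(mxrank_leqif_sup sub).
Qed.

Lemma ind_exists A : exists k, `[< trange (tpow A k) = trange (tpow A k.+1) >].
Proof.
pose r k := \rank (tomx (tpow A k)).
suff [k /trange_rank E] : exists k, r k = r k.+1 by exists k; apply/asboolP.
apply/not_existsP => rE.
have decr k : (r k.+1 < r k)%N.
  rewrite ltn_neqAle; apply/andP; split; first by apply/eqP => /esym/rE.
  by rewrite /r -mxrank_tr -[X in (_ <= X)%N]mxrank_tr mxrankS ?tpowS_sub.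
have bnd k : (r k + k <= r 0)%N.
  by elim: k => [|k IH]; rewrite ?addn0 // addnS (leq_trans _ IH) // ltn_add2r.
by have := bnd (r 0).+1; rewrite addnS ltnNge leq_addl.
Qed.

End Transport.

Definition ind (R : realType) (N : nat) (I : 'I_N -> nat)
    (A : tensor R I I) : nat :=
  ex_minn (ind_exists A).

Definition is_drazin (R : realType) (N : nat) (I : 'I_N -> nat)
    (A X : tensor R I I) : Prop :=
  [/\ tpow A (ind A).+1 *N X = tpow A (ind A),
      X *N A *N X = X
    & A *N X = X *N A].

Lemma drazin_exists (R : realType) (N : nat) (I : 'I_N -> nat)
  (A : tensor R I I) : exists X, is_drazin A X.
Proof.
rewrite /is_drazin; set k := ind A.
have kE : trange (tpow A k) = trange (tpow A k.+1).
  by rewrite /k /ind; case: ex_minnP => m /asboolP.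
set M := tomx A.
have [Y YE] : exists Y, M ^+ k = M ^+ k.+1 * Y.
  have [Y YE] : exists Y, tpow A k = tpow A k.+1 *N Y.
    by apply/trange_sub; rewrite kE.
  by exists (tomx Y); rewrite -mulmxE -!tomxX -tomxM -YE.
have [Z ZE] : exists Z, M ^+ k = Z * M ^+ k.+1.
  apply/submxP; move/trange_rank: kE; rewrite !tomxX => /esym/eqP.
  have sub : (M ^+ k.+1 <= M ^+ k)%MS by rewrite exprS -mulmxE submxMl.
  by rewrite (mxrank_leqif_sup sub).
have [X [X1 X2 X3]] := drazin_ring YE ZE.
exists (ofmx X).
split; apply: (can_inj (@tomxK R N I));
  by rewrite !(tomxX, tomxM) ofmxK !mulmxE.
Qed.

Lemma drazin_unique (R : realType) (N : nat) (I : 'I_N -> nat)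
  (A X Y : tensor R I I) : is_drazin A X -> is_drazin A Y -> X = Y.
Proof.
move=> [X1 X2 X3] [Y1 Y2 Y3]; apply: (can_inj (@tomxK R N I)).
move: X1 X2 X3 Y1 Y2 Y3 => /(congr1 (@tomx R N I)) X1
  /(congr1 (@tomx R N I)) X2 /(congr1 (@tomx R N I)) X3
  /(congr1 (@tomx R N I)) Y1 /(congr1 (@tomx R N I)) Y2
  /(congr1 (@tomx R N I)) Y3.
rewrite !(tomxX, tomxM) !mulmxE in X1 X2 X3 Y1 Y2 Y3.
exact: drazin_ring_unique X1 X2 X3 Y1 Y2 Y3.
Qed.

Definition drazin (R : realType) (N : nat) (I : 'I_N -> nat)
    (A : tensor R I I) : tensor R I I :=
  projT1 (cid (drazin_exists A)).

Definition group_inverse (R : realType) (N : nat) (I : 'I_N -> nat)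
    (A : tensor R I I) (indA : ind A = 1%N) : tensor R I I :=
  drazin A.

Definition is_inner_inverse (R : realType) (N : nat) (I : 'I_N -> nat)
    (A X : tensor R I I) : Prop :=
  A *N X *N A = A.

(* Main.v *)
(** If [x] is the group inverse of [a], then [a = a^3 x^2 = x^2 a^3], so for a
    {1}-inverse [g] of [a^3] we get
    [a g a = x^2 (a^3 g a^3) x^2 = x^2 a^3 x^2 = a x^2 = x]. *)
Require Import Defs.
From mathcomp Require Import all_boot all_order all_algebra.
From mathcomp Require Import boolp classical_sets reals complex.

Local Open Scope tensor_scope.

(** The identity is pure ring theory: writing the left [a] as [x^2 a^3] and the right one as
    [a^3 x^2] puts [g] between two cubes, where it cancels. The bijection [tomx] turns [*N] into the
    matrix product, so the identity passes from square matrices to tensors. *)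

Lemma group_inverse_ring (T : pzRingType) (a x g : T) :
  (a ^+ 2 * x = a -> x * a * x = x -> a * x = x * a ->
   a ^+ 3 * g * a ^+ 3 = a ^+ 3 -> x = a * g * a)%R.
Proof.
move=> a2x xax ax ginv.
have a3x2 : (a = a ^+ 3 * x ^+ 2)%R.
  rewrite GRing.exprSr GRing.expr2 GRing.mulrA -(GRing.mulrA _ a x) ax.
  by rewrite GRing.mulrA a2x -GRing.expr2 a2x.
have x2a3 : (a = x ^+ 2 * a ^+ 3)%R.
  by rewrite {1}a3x2; apply/GRing.commrX/GRing.commr_sym/GRing.commrX/esym.
have -> : (a * g * a = x ^+ 2 * (a ^+ 3 * g * a ^+ 3) * x ^+ 2)%R.
  by rewrite {1}x2a3 [X in (_ * X)%R = _]a3x2 !GRing.mulrA.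
(* What remains is [x^2 a^3 x^2 = a x^2 = x a x = x]. *)
by rewrite ginv -x2a3 GRing.expr2 GRing.mulrA ax xax.
Qed.

Theorem theorem3p21 (R : realType) (N : nat) (I : 'I_N -> nat)
    (I_gt0 : forall s : 'I_N, (0 < I s)%N)
    (A : tensor R I I) (indA : ind A = 1%N)
    (G : tensor R I I) (innerG : is_inner_inverse (tpow A 3) G) :
  group_inverse indA = A *N G *N A.
Proof.
rewrite /group_inverse /drazin; case: cid => X /=.
rewrite /is_drazin indA => -[/(congr1 (@tomx R N I)) AX
  /(congr1 (@tomx R N I)) XAX /(congr1 (@tomx R N I)) AXC].
move/(congr1 (@tomx R N I)): innerG => innerG.
rewrite !(tomxX, tomxM) !mulmxE in AX XAX AXC innerG.
apply: (can_inj (@tomxK R N I)); rewrite !tomxM !mulmxE.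
(* Since the index is 1, [AX] has right-hand side [tomx A ^+ 1], which computes to [tomx A]. *)
exact: group_inverse_ring AX XAX AXC innerG.
Qed.
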